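(* Let $p,q$ be distinct odd primes with $p\equiv 1\pmod 4$, $q\equiv 3\pmod 4$, $\gcd(p-1,q-1)=2$, having a common primitive root $g$, and satisfying $|q-p|<\sqrt{pq}-1$. Let $s$ be the balanced Whiteman generalized cyclotomic sequence of period $N=pq$ defined in the context. Then its 2-adic complexity satisfies $\varphi_2(s)\ge pq-p-q-1$.
   Context: Let $N=pq$ and $e=(p-1)(q-1)/2$. Let $x$ be the unique element of $\mathbb{Z}_N$ with $x\equiv g\pmod p$ and $x\equiv 1\pmod q$. The Whiteman generalized cyclotomic classes of order 2 are $D_i=\{g^{s}x^{i}\bmod N: s=0,1,\dots,e-1\}$ for $i=0,1$; they partition $\mathbb{Z}_N^{*}$. For a prime $r\in\{p,q\}$, let $D_0^{(r)}=\{g^{2t}\bmod r: 0\le t\le \frac{r-1}{2}-1\}$ and $D_1^{(r)}=\{g^{2t+1}\bmod r: 0\le t\le \frac{r-1}{2}-1\}$. For $j=0,1$ let $D_j^{(p)}q=\{yq\bmod N: y\in D_j^{(p)}\}$ and $D_j^{(q)}p=\{yp\bmod N: y\in D_j^{(q)}\}$. Define $C_0=\{0\}\cup D_0\cup D_0^{(p)}q\cup D_0^{(q)}p$ and $C_1=D_1\cup D_1^{(p)}q\cup D_1^{(q)}p$, so $\mathbb{Z}_N=C_0\cup C_1$ (disjoint). The sequence $s=\{s_i\}$ of period $N$ is defined by $s_i=0$ if $i\bmod N\in C_0$ and $s_i=1$ if $i\bmod N\in C_1$. For a binary sequence $s$ of period $N$, let $S(2)=\sum_{i=0}^{N-1}s_i2^{i}$;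 its 2-adic complexity is $\varphi_2(s)=\left\lfloor \log_2\!\left(\frac{2^{N}-1}{\gcd(2^{N}-1,S(2))}+1\right)\right\rfloor$. *)

(* Defs.v *)
From mathcomp Require Import all_boot all_order.
Set Implicit Arguments. Unset Strict Implicit. Unset Printing Implicit Defensive.

Definition primitive_root_mod (r g : nat) : bool :=
  (g ^ r.-1 %% r == 1) && [forall k : 'I_r.-1, (0 < k) ==> (g ^ k %% r != 1)].

Section Whiteman.
Variables p q g : nat.

Definition N := p * q.
Definition e := (p.-1 * q.-1) %/ 2.

Definition xW : nat := chinese p q g 1 %% N.

Definition Dw (i : nat) : seq nat := [seq (g ^ s * xW ^ i) %% N | s <- iota 0 e].

Definition Dr (r j : nat) : seq nat := [seq g ^ (2 * t + j) %% r | t <- iota 0 (r.-1 %/ 2)].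

Definition Dpq (j : nat) : seq nat := [seq (y * q) %% N | y <- Dr p j].
Definition Dqp (j : nat) : seq nat := [seq (y * p) %% N | y <- Dr q j].

Definition C0 : seq nat := 0 :: Dw 0 ++ Dpq 0 ++ Dqp 0.
Definition C1 : seq nat := Dw 1 ++ Dpq 1 ++ Dqp 1.

(* the sequence: s_i = 1 iff i mod N in C_1 (and 0 iff in C_0) *)
Definition sW (i : nat) : nat := if i %% N \in C1 then 1 else 0.

Definition S2 : nat := \sum_(i < N) sW i * 2 ^ i.

End Whiteman.

Definition two_adic_complexity (n : nat) (s : nat -> nat) : nat :=
  let S := \sum_(i < n) s i * 2 ^ i in
  trunc_log 2 ((2 ^ n - 1) %/ gcdn (2 ^ n - 1) S + 1).

(* Main.v *)
(* By quadratic characters and the Chinese remainder theorem, for every ring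
   element w with w^(pq) = 1 the sum of (-1)^(s_i) w^i over a period equals
   1 + G_p + G_q + eps G_p G_q, where eps = (q/p)(p/q) and G_p, G_q are the
   quadratic Gauss sums attached to w^q and w^p. Take w = 2 modulo
   d = gcd(2^(pq) - 1, S(2)), so that this expression vanishes.
   If a prime r dividing d also divided 2^q - 1, then G_p = 0 and G_q = -1 in
   F_r, so 1 = G_q^2 = -q, i.e. r | q + 1; but 2^p has order q modulo r, hence
   q | r - 1, which is impossible for odd r; likewise with p and q exchanged.
   Hence G_p^2 = p and G_q^2 = -q modulo d, and eliminating the Gauss sums shows
   that d divides ((p+1)(q+1))^2 - 4p(1 + eps q)^2, which is positive and at
   most 2^(p+q+1). *)

Require Import Defs.
From mathcomp Require Import all_boot all_order all_algebra all_field.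
From mathcomp Require Import ring zify.
Set Implicit Arguments. Unset Strict Implicit. Unset Printing Implicit Defensive.
Import GRing.Theory Num.Theory.
Local Open Scope ring_scope.

(** * Quadratic character and Gauss sums over a finite field *)

Section QuadraticCharacter.
Variable F : finFieldType.
Implicit Types x y z : F.

(** Euler's criterion serves as the definition. The values are integers, so that they can be cast
    into whichever ring carries the Gauss sum. *)
Definition quadchar y : int :=
  if y == 0 then 0 else if y ^+ #|F|.-1./2 == 1 then 1 else -1.

Lemma quadchar0 : quadchar 0 = 0.
Proof. by rewrite /quadchar eqxx. Qed.

Lemma quadchar_neq0 y : (quadchar y != 0) = (y != 0).
Proof. by rewrite /quadchar; case: (y == 0) => //; case: ifP. Qed.

Lemma quadcharP y : y != 0 -> quadchar y = 1 \/ quadchar y = -1.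
Proof. by rewrite /quadchar => /negPf ->; case: ifP; [left|right]. Qed.

Lemma quadchar_sq y : y != 0 -> quadchar y * quadchar y = 1.
Proof. by move/quadcharP=> [] ->. Qed.

Lemma expf_half_card y :
  odd #|F| -> y != 0 -> y ^+ #|F|.-1./2 = 1 \/ y ^+ #|F|.-1./2 = -1.
Proof.
move=> oddF y0; apply/pred2P; rewrite -sqrf_eq1 -exprM muln2 halfK.
have F0 : (0 < #|F|)%N by apply/card_gt0P; exists 0.
rewrite -subn1 oddB // oddF subn0.
by apply/eqP/(mulfI y0); rewrite -exprS subn1 prednK // expf_card mulr1.
Qed.

Lemma quadcharM x y :
  odd #|F| -> quadchar (x * y) = quadchar x * quadchar y.
Proof.
move=> oddF; have [->|x0] := eqVneq x 0; first by rewrite mul0r quadchar0 mul0r.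
have [->|y0] := eqVneq y 0; first by rewrite mulr0 quadchar0 mulr0.
rewrite /quadchar mulf_eq0 (negPf x0) (negPf y0) /= exprMn.
case: (eqVneq (x ^+ _) 1) => [->|x1]; first by rewrite !mul1r.
have [/eqP|xN] := expf_half_card oddF x0; first by rewrite (negPf x1).
have N1 : (-1 == 1 :> F) = false by rewrite -xN; exact/negbTE.
rewrite xN; have [->|->] := expf_half_card oddF y0; first by rewrite eqxx mulr1 N1.
by rewrite N1 mulrNN mulr1 eqxx.
Qed.

(** Multiplication by the non-residue [c] permutes the field and negates the sum. *)
Lemma sum_quadchar c :
  odd #|F| -> quadchar c = -1 -> \sum_y quadchar y = 0.
Proof.
move=> oddF qc; have c0 : c != 0 by rewrite -quadchar_neq0 qc.
have: \sum_y quadchar y = - \sum_y quadchar y.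
  rewrite {1}(reindex_inj (mulfI c0)) /= -sumrN.
  by apply: eq_bigr => y _; rewrite quadcharM // qc mulN1r.
by lia.
Qed.

(** The non-residue [c] rules out -1 = 1 in [F], so the test in [quadchar] really separates the two
    signs. *)
Lemma quadcharN1 c : odd #|F| -> quadchar c = -1 ->
  quadchar (-1) = (-1) ^+ #|F|.-1./2.
Proof.
move=> oddF qc; have c0 : c != 0 by rewrite -quadchar_neq0 qc.
rewrite /quadchar oppr_eq0 oner_eq0 -!(signr_odd _ _./2).
case: odd; rewrite ?expr0 ?eqxx // expr1.
case: eqP => // N1; move: qc; rewrite /quadchar (negPf c0).
by have [->|->] := expf_half_card oddF c0; rewrite ?N1 eqxx.
Qed.

Variables (R : comNzRingType) (psi : F -> R).
Hypotheses (psi0 : psi 0 = 1) (psiD : {morph psi : x y / x + y >-> x * y}).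

Definition gauss_sum := \sum_y (quadchar y)%:~R * psi y.

(** Substituting z = y t in the double sum leaves the sum over t of chi(t) times the sum of psi(y (1
    + t)) over nonzero y. That inner sum is #|F| - 1 for t = -1. For any other t it is the full sum
    of psi minus 1, and the chi(t) with t <> -1 add up to -chi(-1). The full sum of psi is kept,
    since [R] may have zero divisors. *)
Lemma gauss_sum_sq : odd #|F| -> \sum_y quadchar y = 0 ->
  gauss_sum ^+ 2 = (quadchar (-1))%:~R * (#|F|%:R - \sum_y psi y).
Proof.
move=> oddF sum0.
have inner y : y != 0 ->
    \sum_z (quadchar y)%:~R * psi y * ((quadchar z)%:~R * psi z)
    = \sum_t (quadchar t)%:~R * psi (y * (1 + t)).
  move=> y0; rewrite (reindex_inj (mulfI y0)) /=; apply: eq_bigr => t _.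
  rewrite mulrDr mulr1 psiD quadcharM // mulrACA -intrM.
  by rewrite [X in X%:~R]mulrA quadchar_sq // mul1r.
rewrite expr2 {1}/gauss_sum big_distrl /= (bigD1 0) //= quadchar0 !mul0r add0r.
have -> : \sum_(y | y != 0) (quadchar y)%:~R * psi y * gauss_sum
   = \sum_(y | y != 0) \sum_t (quadchar t)%:~R * psi (y * (1 + t)).
  by apply: eq_bigr => y y0; rewrite -inner // big_distrr.
rewrite exchange_big (bigD1 (-1)) //=.
under eq_bigr do rewrite addrN mulr0 psi0 mulr1.
rewrite sumr_const cardC1.
have -> : \sum_(t | t != -1) \sum_(y | y != 0) (quadchar t)%:~R * psi (y * (1 + t))
   = \sum_(t | t != -1) (quadchar t)%:~R * (\sum_y psi y - 1).
  apply: eq_bigr => t tN; rewrite -big_distrr /=; congr (_ * _).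
  have t1 : 1 + t != 0 by rewrite addrC addr_eq0.
  rewrite [in RHS](reindex_inj (mulIf t1)) /= [in RHS](bigD1 0) //=.
  by rewrite mul0r psi0 addrAC subrr add0r.
rewrite -big_distrl /= -rmorph_sum /=.
have -> : \sum_(t | t != -1) quadchar t = - quadchar (-1).
  move: sum0; rewrite (bigD1 (-1)) //= => /eqP; rewrite addr_eq0 => /eqP ->.
  by rewrite opprK.
have F0 : (0 < #|F|)%N by apply/card_gt0P; exists 0.
rewrite -mulr_natr -{2}(prednK F0) -natr1 rmorphN /=; ring.
Qed.

(** Translation by [x] multiplies the sum by [psi x]. The sum itself vanishes once [psi x - 1] can
    be cancelled. *)
Lemma sum_add_char x : (psi x - 1) * \sum_y psi y = 0.
Proof.
rewrite mulrBl mul1r big_distrr /= [X in _ - X](reindex_inj (addrI x)) /=.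
by under [X in _ - X]eq_bigr do rewrite psiD; rewrite subrr.
Qed.

Lemma gauss_sum_trivial :
  \sum_y quadchar y = 0 -> (forall y, psi y = 1) -> gauss_sum = 0.
Proof.
move=> sum0 psi1; rewrite /gauss_sum.
by under eq_bigr do rewrite psi1 mulr1; rewrite -rmorph_sum sum0.
Qed.

End QuadraticCharacter.

(** * Prime fields, primitive roots and Gauss sums attached to a p-th root of unity *)

Lemma natr_Fp_eq (p m n : nat) : prime p ->
  (m%:R == n%:R :> 'F_p) = (m == n %[mod p])%N.
Proof.
move=> p_pr.
have valE k : (k%:R : 'F_p) = (k %% p)%N :> nat := val_Fp_nat p_pr k.
by apply/eqP/eqP => mn; [rewrite -!valE mn | apply: ord_inj; rewrite !valE].
Qed.

Lemma natr_Fp_eq0 (p m : nat) : prime p -> (m%:R == 0 :> 'F_p) = (p %| m)%N.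
Proof. by move=> p_pr; rewrite -[0]/(0%:R) natr_Fp_eq // mod0n. Qed.

Section PrimeField.
Variables (p g : nat).
Hypotheses (p_pr : prime p) (p_gt2 : (2 < p)%N).

Lemma odd_card_Fp : odd #|'F_p|.
Proof. by rewrite card_Fp //; have [p2|//] := even_prime p_pr; move: p_gt2; rewrite p2. Qed.

Section Powers.
Variables (R : comNzRingType) (a : R).
Hypothesis a1 : a ^+ p = 1.

(** Since a^p = 1, this is an additive character of ['F_p], although it is written with the
    representative of [y]. *)
Definition powF (y : 'F_p) : R := a ^+ (y : nat).

Lemma powF_nat (m : nat) : powF m%:R = a ^+ m.
Proof. by rewrite /powF [nat_of_ord _](val_Fp_nat p_pr) expr_mod. Qed.

Lemma powF0 : powF 0 = 1.
Proof. by rewrite -[0]/(0%:R) powF_nat. Qed.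

Lemma powF1 : powF 1 = a.
Proof. by rewrite -[1]/(1%:R) powF_nat. Qed.

Lemma powFD : {morph powF : x y / x + y >-> x * y}.
Proof.
move=> x y; rewrite -[x]natr_Zp -[y]natr_Zp -natrD !powF_nat; exact: exprD.
Qed.
End Powers.

Hypothesis g_prim : primitive_root_mod p g.

Lemma primitive_root_modP : p.-1.-primitive_root (g%:R : 'F_p).
Proof.
have p1 : (0 < p.-1)%N by lia.
case/andP: g_prim => gp /forallP gk.
have gk1 (k : nat) : ((g%:R : 'F_p) ^+ k == 1) = (g ^ k %% p == 1)%N.
  by rewrite -natrX -[1]/(1%:R) natr_Fp_eq // (modn_small (prime_gt1 p_pr)).
apply/andP; split=> //; apply/forallP => i; rewrite unity_rootE gk1.
have [->|ne] := eqVneq i.+1 p.-1; first by rewrite gp.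
have lti : (i.+1 < p.-1)%N by rewrite ltn_neqAle ne ltn_ord.
by rewrite (negPf (gk (Ordinal lti))).
Qed.

Lemma quadchar_primitive : quadchar (g%:R : 'F_p) = -1.
Proof.
have gP := primitive_root_modP; have oddp := odd_card_Fp.
rewrite card_Fp // in oddp.
rewrite /quadchar card_Fp // (prim_root_eq0 gP) ifN; last by lia.
rewrite ifN // -(prim_order_dvd gP); apply/negP => /dvdn_leq.
by move: p_gt2 oddp; lia.
Qed.

Lemma quadchar_primitiveX k : quadchar ((g%:R : 'F_p) ^+ k) = (-1) ^+ k.
Proof.
elim: k => [|k IHk].
  by rewrite !expr0 /quadchar oner_eq0 expr1n eqxx.
by rewrite !exprS quadcharM ?odd_card_Fp // quadchar_primitive IHk.
Qed.

Lemma primitive_log (y : 'F_p) :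
  y != 0 -> exists2 k, (k < p.-1)%N & y = g%:R ^+ k.
Proof.
move=> y0; have yp : y ^+ p.-1 = 1.
  apply: (mulfI y0); rewrite -exprS prednK ?prime_gt0 //.
  by have := expf_card y; rewrite card_Fp // mulr1.
by have [k ->] := prim_rootP primitive_root_modP yp; exists k.
Qed.

(** The character of g^k is (-1)^k, so the non-residues are the odd powers of g. As p - 1 is even, k
    < p - 1 puts the half of k in the range that [Dr] enumerates. *)
Lemma mem_Dr1 (n : nat) : (n < p)%N ->
  (n \in Dr g p 1) = (quadchar (n%:R : 'F_p) == -1).
Proof.
move=> np; apply/mapP/eqP => [[t _ ->]|qn].
  rewrite Fp_nat_mod // natrX quadchar_primitiveX addn1 exprS mulnC exprM.
  by rewrite sqrr_sign mulr1.
have n0 : n%:R != 0 :> 'F_p by rewrite -quadchar_neq0 qn.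
have [k kp nk] := primitive_log n0.
have oddk : odd k.
  by move: qn; rewrite nk quadchar_primitiveX -signr_odd; case: odd.
exists k./2.
  by rewrite mem_iota; have := odd_card_Fp; rewrite card_Fp // divn2; lia.
apply/eqP; rewrite -{1}(modn_small np) -natr_Fp_eq // nk natrX.
by have -> : (2 * k./2 + 1 = k)%N by lia.
Qed.

Definition gaussF (R : comNzRingType) (a : R) : R := gauss_sum (@powF R a).

Lemma sum_quadchar_Fp : \sum_(y : 'F_p) quadchar y = 0.
Proof. exact: sum_quadchar odd_card_Fp quadchar_primitive. Qed.

Lemma gaussF1 (R : comNzRingType) : gaussF (1 : R) = 0.
Proof.
apply: gauss_sum_trivial; first exact: sum_quadchar_Fp.
by move=> y; rewrite /powF expr1n.
Qed.

(** Invertibility of a - 1, rather than a <> 1, makes the character sum vanish in rings such as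
    ['Z_d] that need not be fields. *)
Lemma gaussF_sq (R : comUnitRingType) (a : R) :
  a ^+ p = 1 -> a - 1 \is a GRing.unit ->
  gaussF a ^+ 2 = (-1) ^+ p.-1./2 * p%:R.
Proof.
move=> ap a1; rewrite (gauss_sum_sq (powF0 ap) (powFD ap) odd_card_Fp).
  rewrite (quadcharN1 odd_card_Fp quadchar_primitive) card_Fp //.
  rewrite [X in _ - X](_ : _ = 0) ?subr0 ?rmorphXn ?rmorphN1 //.
  by apply: (mulrI a1); have := sum_add_char (powFD ap) 1; rewrite powF1 // mulr0.
exact: sum_quadchar_Fp.
Qed.

(** If the Gauss sum were -1, its square would give 1 = p or 1 = -p in ['F_r], hence r <= p + 1. But
    [a] has order p, so p divides r - 1 and r > p. Then r = p + 1 is even. *)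
Lemma gaussF_neqN1 (r : nat) (a : 'F_r) :
  prime r -> odd r -> a ^+ p = 1 -> 1 + gaussF a != 0.
Proof.
move=> r_pr oddr ap; have [->|a1] := eqVneq a 1.
  by rewrite gaussF1 addr0 oner_eq0.
apply/negP; rewrite addrC addr_eq0 => /eqP GN1.
have oddp := odd_card_Fp; rewrite card_Fp // in oddp.
have r_le : (r <= p.+1)%N.
  have unit_a1 : a - 1 \is a GRing.unit by rewrite unitfE subr_eq0.
  have := gaussF_sq ap unit_a1; rewrite GN1 sqrrN expr1n -signr_odd.
  case: odd; rewrite ?expr0 ?expr1 ?mul1r ?mulN1r.
    move/eqP; rewrite eq_sym -subr_eq0 -opprD oppr_eq0 natr1 natr_Fp_eq0 //.
    exact: dvdn_leq.
  move/eqP; rewrite eq_sym -[1]/(1%:R) natr_Fp_eq // eqn_mod_dvd ?prime_gt0 //.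
  by move/dvdn_leq; rewrite subn_gt0 prime_gt1 // => /(_ isT); lia.
have r_ge : (p < r)%N.
  have [m am mp] := prim_order_exists (prime_gt0 p_pr) ap.
  have a0 : a != 0.
    apply: contra_eq_neq ap => ->.
    by rewrite expr0n eqn0Ngt prime_gt0 // eq_sym oner_eq0.
  have ar : a ^+ r.-1 = 1.
    apply: (mulfI a0); rewrite -exprS prednK ?prime_gt0 //.
    by have := expf_card a; rewrite card_Fp // mulr1.
  have /primeP[_ /(_ m mp) /pred2P[m1|m_p]] := p_pr.
    by move/prim_expr_order: am; rewrite m1 expr1 => /eqP; rewrite (negPf a1).
  move/eqP: ar; rewrite -(prim_order_dvd am) m_p => /dvdn_leq.
  by move: (prime_gt1 r_pr); clear; lia.
have rE : r = p.+1 by apply/eqP; rewrite eqn_leq r_le.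
by move: oddr; rewrite rE /= oddp.
Qed.
End PrimeField.

(** * Residues modulo pq as pairs of residues *)

Section TwoPrimes.
Variables (p q g : nat).
Hypotheses (p_pr : prime p) (q_pr : prime q) (neq_pq : p != q).
Hypothesis (p_gt2 : (2 < p)%N).
Hypothesis (gp : primitive_root_mod p g).

Lemma coprime_pq : coprime p q.
Proof. by rewrite prime_coprime // dvdn_prime2. Qed.

Lemma natr_Fpq_eq (m n : nat) : (m == n %[mod p * q])%N =
  (m%:R == n%:R :> 'F_p) && (m%:R == n%:R :> 'F_q).
Proof. by rewrite !natr_Fp_eq // chinese_remainder // coprime_pq. Qed.

(** Under the Chinese remainder theorem y q is the pair (q y, 0). The factor q is kept apart from
    [y], so that no Legendre symbol of q enters here. *)
Lemma mem_scaled_Dr1 (i : nat) :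
  reflect (exists y : 'F_p,
      [/\ quadchar y = -1, i%:R = q%:R * y & i%:R = 0 :> 'F_q])
    (i %% (p * q) \in [seq (y * q) %% (p * q) | y <- Dr g p 1])%N.
Proof.
have eqE (n : nat) : (i %% (p * q) == (n * q) %% (p * q))%N =
    (i%:R == q%:R * n%:R :> 'F_p) && (i%:R == 0 :> 'F_q).
  by rewrite natr_Fpq_eq !natrM pchar_Fp_0 // mulr0 mulrC.
apply: (iffP mapP) => [[n nD /eqP]|[y [qy yp yq]]].
  rewrite eqE => /andP[/eqP ip /eqP iq]; exists n%:R; split=> //.
  by apply/eqP; rewrite -(mem_Dr1 p_pr p_gt2 gp) //; case/mapP: nD => t _ ->; rewrite ltn_mod prime_gt0.
exists (y : nat); last by apply/eqP; rewrite eqE natr_Zp yp yq !eqxx.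
have yltp : (y < p)%N by rewrite -[X in (_ < X)%N](Fp_cast p_pr).
by rewrite (mem_Dr1 p_pr p_gt2 gp) // natr_Zp qy.
Qed.
End TwoPrimes.

(** * The Whiteman classes in terms of quadratic characters *)

Section Whiteman.
Variables (p q g : nat).
Hypotheses (p_pr : prime p) (q_pr : prime q) (neq_pq : p != q).
Hypotheses (p_gt2 : (2 < p)%N) (q_gt2 : (2 < q)%N).
Hypotheses (gp : primitive_root_mod p g) (gq : primitive_root_mod q g).
Hypotheses (p4 : (p %% 4 = 1)%N) (q4 : (q %% 4 = 3)%N).
Hypothesis gcd2 : gcdn p.-1 q.-1 = 2%N.

Lemma natr_xW : (xW p q g)%:R = g%:R :> 'F_p /\ (xW p q g)%:R = 1 :> 'F_q.
Proof.
split; apply/eqP.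
  rewrite natr_Fp_eq // /xW /N modn_dvdm ?dvdn_mulr //.
  by rewrite (chinese_modl (coprime_pq p_pr q_pr neq_pq)).
rewrite -[1]/(1%:R) natr_Fp_eq // /xW /N modn_dvdm ?dvdn_mull //.
by rewrite (chinese_modr (coprime_pq p_pr q_pr neq_pq)).
Qed.

(* Since (q-1)/2 is odd and coprime to p-1, exponents of the same parity can be
   matched simultaneously modulo p-1 and q-1. *)
Lemma common_exponent (k l : nat) : odd k = odd l ->
  exists2 s, (s < e p q)%N & (s = k %[mod p.-1])%N /\ (s = l %[mod q.-1])%N.
Proof.
have p2 : (2 %| p.-1)%N by lia.
move=> kl; pose m := (q.-1)./2.
have qm : q.-1 = (2 * m)%N by rewrite /m; lia.
have oddm : odd m by rewrite /m; lia.
have cop : coprime p.-1 m.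
  rewrite /coprime; set h := gcdn _ _.
  have h2 : (h %| 2)%N.
    by rewrite -gcd2 dvdn_gcd dvdn_gcdl qm dvdn_mull // dvdn_gcdr.
  have hm : (h %| m)%N by rewrite dvdn_gcdr.
  have oddh := dvdn_odd hm oddm.
  move: h2 oddh (@dvdn_leq h 2 isT h2); clear hm; clearbody h.
  by case: h => [|[|[|h]]].
have eE : e p q = (p.-1 * m)%N by rewrite /e qm mulnCA mulKn.
exists (chinese p.-1 m k l %% e p q)%N; first by rewrite ltn_mod eE; lia.
have sk : (chinese p.-1 m k l %% e p q = k %[mod p.-1])%N.
  by rewrite eE modn_dvdm ?dvdn_mulr // (chinese_modl cop).
split=> //; set s := (chinese _ _ _ _ %% _)%N in sk *.
have sl : (s = l %[mod m])%N.
  by rewrite /s eE modn_dvdm ?dvdn_mull // (chinese_modr cop).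
have odds : odd s = odd l.
  have := congr1 (modn^~ 2) sk; rewrite /= !(modn_dvdm _ p2) !modn2 kl.
  by case: odd; case: odd.
apply/eqP; rewrite qm chinese_remainder ?coprime2n // sl eqxx andbT.
by rewrite !modn2 odds.
Qed.

Lemma odd_add_pred2 (k l : nat) : odd (k + l) -> odd (k + p.-2) = odd l.
Proof. by move: p4 p_gt2; lia. Qed.

(** The element g^s x is the pair (g^(s+1), g^s), whose characters multiply to -1. Conversely, the
    product -1 makes both residues nonzero, with discrete logarithms of opposite parity. *)
Lemma mem_Dw1 (i : nat) : (i %% (p * q) \in Dw p q g 1)%N =
  (quadchar (i%:R : 'F_p) * quadchar (i%:R : 'F_q) == -1).
Proof.
have [xp xq] := natr_xW.
have eqE s : (i %% (p * q) == (g ^ s * xW p q g ^ 1) %% N p q)%N =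
    (i%:R == g%:R ^+ s.+1 :> 'F_p) && (i%:R == g%:R ^+ s :> 'F_q).
  by rewrite (natr_Fpq_eq p_pr q_pr neq_pq) !natrM !natrX !expr1 xp xq mulr1 -exprSr.
apply/mapP/eqP => [[s _ /eqP]|pq1].
  rewrite eqE => /andP[/eqP -> /eqP ->].
  rewrite !quadchar_primitiveX // exprS mulN1r mulNr -exprD addnn.
  by rewrite -signr_odd odd_double.
have ip0 : i%:R != 0 :> 'F_p.
  by rewrite -quadchar_neq0; apply: contra_eq_neq pq1 => ->; rewrite mul0r.
have iq0 : i%:R != 0 :> 'F_q.
  by rewrite -quadchar_neq0; apply: contra_eq_neq pq1 => ->; rewrite mulr0.
have [k kp ik] := primitive_log p_pr p_gt2 gp ip0.
have [l lq il] := primitive_log q_pr q_gt2 gq iq0.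
have oddkl : odd (k + l).
  move: pq1; rewrite ik il !quadchar_primitiveX // -exprD -signr_odd.
  by case: odd.
(* The exponent must satisfy s + 1 = k modulo p - 1 and s = l modulo q - 1; adding p - 2 stands for
   subtracting 1 there. *)
have [|s se [sk sl]] := @common_exponent (k + p.-2) l; first exact: odd_add_pred2.
exists s; first by rewrite mem_iota.
apply/eqP; rewrite eqE ik il.
rewrite (eq_prim_root_expr (primitive_root_modP p_pr p_gt2 gp)).
rewrite (eq_prim_root_expr (primitive_root_modP q_pr q_gt2 gq)) sl eqxx andbT.
rewrite -[s.+1]add1n -modnDmr sk modnDmr.
by rewrite addnCA add1n -subn2 -subSn ?subSS ?subn1 ?modnDr // ltnW.
Qed.

Definition whiteman_sign : int :=
  quadchar (q%:R : 'F_p) * quadchar (p%:R : 'F_q).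

Lemma q_neq0_Fp : q%:R != 0 :> 'F_p.
Proof. by rewrite natr_Fp_eq0 // dvdn_prime2. Qed.

Lemma p_neq0_Fq : p%:R != 0 :> 'F_q.
Proof. by rewrite natr_Fp_eq0 // dvdn_prime2 // eq_sym. Qed.

(** Writing the index as q a + p b makes w^i split into (w^q)^a (w^p)^b. The residues are then q a
    and p b, which is where the two Legendre symbols in [whiteman_sign] come from. The four terms on
    the right are supported on zero, the nonzero multiples of q, those of p, and the units. *)
Lemma sW_sign (a : 'F_p) (b : 'F_q) :
  1 - 2 * (sW p q g (q * a + p * b))%:Z =
  (a == 0)%:Z * (b == 0)%:Z + quadchar a * (b == 0)%:Z
  + (a == 0)%:Z * quadchar b + whiteman_sign * quadchar a * quadchar b.
Proof.
have q0 := q_neq0_Fp; have p0 := p_neq0_Fq.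
set i := (q * a + p * b)%N.
have ip : i%:R = q%:R * a.
  by rewrite /i natrD !natrM pchar_Fp_0 // mul0r addr0 natr_Zp.
have iq : i%:R = p%:R * b.
  by rewrite /i natrD !natrM pchar_Fp_0 // mul0r add0r natr_Zp.
have inPQ : (i %% (p * q) \in Dpq p q g 1)%N = (b == 0) && (quadchar a == -1).
  apply/(mem_scaled_Dr1 p_pr q_pr neq_pq p_gt2 gp)/andP => [[y [qy]]|[/eqP b0 /eqP qa]].
    rewrite ip iq => /(mulfI q0) -> /eqP; rewrite mulf_eq0 (negPf p0) /= => ->.
    by rewrite qy.
  by exists a; rewrite ip iq b0 mulr0.
have inQP : (i %% (p * q) \in Dqp p q g 1)%N = (a == 0) && (quadchar b == -1).
  have neq_qp : q != p by rewrite eq_sym.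
  rewrite /Dqp /N (mulnC p q).
  apply/(mem_scaled_Dr1 q_pr p_pr neq_qp q_gt2 gq)/andP.
    move=> [y [qy]]; rewrite ip iq => /(mulfI p0) -> /eqP.
    by rewrite mulf_eq0 (negPf q0) /= => ->; rewrite qy.
  by move=> [/eqP a0 /eqP qb]; exists b; rewrite ip iq a0 mulr0.
have inW : (i %% (p * q) \in Dw p q g 1)%N =
    (whiteman_sign * quadchar a * quadchar b == -1).
  rewrite mem_Dw1 ip iq !quadcharM ?odd_card_Fp //.
  by rewrite mulrACA mulrA.
rewrite /sW /C1 !mem_cat inW inPQ inQP.
have [->|a0] := eqVneq a 0; have [->|b0] := eqVneq b 0;
  rewrite ?quadchar0 ?mulr0 ?mul0r //=.
- by have [->|->] := quadcharP b0.
- by have [->|->] := quadcharP a0.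
rewrite /whiteman_sign.
by have [->|->] := quadcharP q0; have [->|->] := quadcharP p0;
   have [->|->] := quadcharP a0; have [->|->] := quadcharP b0.
Qed.

(** * The signed generating sum and the relation between the two Gauss sums *)

Section GaussSums.
Variables (R : comNzRingType) (w : R).
Hypothesis w1 : w ^+ (p * q) = 1.

Lemma sum_CRT (f : nat -> R) : (forall i, f (i %% (p * q))%N = f i) ->
  \sum_(i < p * q) f i = \sum_(a : 'F_p) \sum_(b : 'F_q) f (q * a + p * b)%N.
Proof.
move=> f_mod; have pq0 : (0 < p * q)%N by rewrite muln_gt0 !prime_gt0.
pose h (ab : 'F_p * 'F_q) : 'I_(p * q) :=
  Ordinal (ltn_pmod (q * ab.1 + p * ab.2) pq0).
have h_inj : injective h.
  move=> [a b] [a' b'] /(congr1 val) /eqP /=; rewrite (natr_Fpq_eq p_pr q_pr neq_pq).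
  rewrite !natrD !natrM !pchar_Fp_0 // !mul0r !addr0 !add0r !natr_Zp.
  case/andP=> /eqP/(mulfI q_neq0_Fp) -> /eqP/(mulfI p_neq0_Fq) ->.
  by [].
have h_bij : bijective h.
  by apply: inj_card_bij h_inj _; rewrite card_prod !card_Fp // card_ord.
rewrite (reindex h) /=; last exact: onW_bij.
by rewrite pair_big /=; apply: eq_bigr => -[a b] _ /=; rewrite f_mod.
Qed.

Lemma whiteman_sum : \sum_(i < p * q) (1 - 2 * (sW p q g i)%:Z)%:~R * w ^+ i =
  1 + gaussF p (w ^+ q) + gaussF q (w ^+ p)
  + whiteman_sign%:~R * gaussF p (w ^+ q) * gaussF q (w ^+ p).
Proof.
rewrite (sum_CRT (f := fun i => (1 - 2 * (sW p q g i)%:Z)%:~R * w ^+ i)); last first.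
  by move=> i; rewrite /sW modn_mod expr_mod.
pose A := w ^+ q; pose B := w ^+ p.
(* [U] and [V] carry the indicators of zero and sum to 1, while [G] and [H] sum to the Gauss sums;
   the four terms of [sW_sign] become UV, GV, UH and GH. *)
pose U (a : 'F_p) : R := (a == 0)%:R * powF A a.
pose V (b : 'F_q) : R := (b == 0)%:R * powF B b.
pose G (a : 'F_p) : R := (quadchar a)%:~R * powF A a.
pose H (b : 'F_q) : R := (quadchar b)%:~R * powF B b.
have Up : \sum_a U a = 1.
  rewrite (bigD1 0) //= big1 => [|a /negPf a0]; last by rewrite /U a0 mul0r.
  by rewrite /U eqxx mul1r addr0 /powF expr0.
have Vq : \sum_b V b = 1.
  rewrite (bigD1 0) //= big1 => [|b /negPf b0]; last by rewrite /V b0 mul0r.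
  by rewrite /V eqxx mul1r addr0 /powF expr0.
have sumM (f : 'F_p -> R) (h : 'F_q -> R) :
    \sum_a \sum_b f a * h b = (\sum_a f a) * \sum_b h b.
  by rewrite big_distrl; apply: eq_bigr => a _; rewrite big_distrr.
transitivity (\sum_a \sum_b U a * V b + \sum_a \sum_b G a * V b
  + \sum_a \sum_b U a * H b
  + whiteman_sign%:~R * \sum_a \sum_b G a * H b).
  rewrite big_distrr -!big_split; apply: eq_bigr => a _ /=.
  rewrite big_distrr -!big_split; apply: eq_bigr => b _ /=.
  rewrite sW_sign exprD !exprM -/A -/B /U /V /G /H /powF.
  rewrite !rmorphD !rmorphM /= -!pmulrn; ring.
by rewrite !sumM Up Vq mul1r mulr1 mul1r !mulrA.
Qed.

(** The signed sum is the geometric sum of w minus 2 S(2). For w = 2 the factor w - 1 is 1, so the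
    geometric sum vanishes in any ring where w^(pq) = 1. *)
Lemma gauss_relation : (2 : R) = w -> (S2 p q g)%:R = 0 :> R ->
  1 + gaussF p (w ^+ q) + gaussF q (w ^+ p)
  + whiteman_sign%:~R * gaussF p (w ^+ q) * gaussF q (w ^+ p) = 0.
Proof.
move=> w2 S0; rewrite -whiteman_sum.
have -> : \sum_(i < p * q) (1 - 2 * (sW p q g i)%:Z)%:~R * w ^+ i =
    \sum_(i < p * q) w ^+ i - 2 * (S2 p q g)%:R.
  rewrite /S2 rmorph_sum big_distrr -sumrB; apply: eq_bigr => i _ /=.
  rewrite rmorphB rmorphM /= -pmulrn natrM natrX -w2; ring.
have : (w - 1) * \sum_(i < p * q) w ^+ i = 0 by rewrite -subrX1 w1 subrr.
have w11 : w - 1 = 1 by rewrite -w2; ring.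
by rewrite w11 mul1r S0 mulr0 subr0.
Qed.
End GaussSums.

Lemma whiteman_signP : whiteman_sign = 1 \/ whiteman_sign = -1.
Proof.
rewrite /whiteman_sign.
have [->|->] := quadcharP q_neq0_Fp; have [->|->] := quadcharP p_neq0_Fq;
by [left | right].
Qed.

(** This supplies the units w^q - 1 and w^p - 1 modulo d that [gaussF_sq] requires. A common prime
    factor would kill one Gauss sum and force the other to be -1. *)
Lemma coprime_gcd_S2 (d : nat) : (d %| 2 ^ (p * q) - 1)%N -> (d %| S2 p q g)%N ->
  coprime d (2 ^ q - 1) /\ coprime d (2 ^ p - 1).
Proof.
move=> dM dS.
have d_gt0 : (0 < d)%N.
  apply: dvdn_gt0 dM; rewrite subn_gt0 -[1%N](expn0 2) ltn_exp2l //.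
  by rewrite muln_gt0 !prime_gt0.
have mod_prime (n r : nat) : prime r -> (r %| d)%N -> (r %| 2 ^ n - 1)%N ->
    [/\ odd r, (2 : 'F_r) ^+ (p * q) = 1, (S2 p q g)%:R = 0 :> 'F_r
      & (2 : 'F_r) ^+ n = 1].
  move=> r_pr rd rn.
  have X1 k : (r %| 2 ^ k - 1)%N -> (2 : 'F_r) ^+ k = 1.
    rewrite -natr_Fp_eq0 // natrB ?expn_gt0 // natrX subr_eq0 => /eqP //.
  have rM := X1 _ (dvdn_trans rd dM); split; last exact: X1.
  - have [r2|//] := even_prime r_pr.
    move: (dvdn_trans rd dM); rewrite r2 dvdn2 oddB ?expn_gt0 // oddX.
    by rewrite -[_ == 0]negbK -lt0n muln_gt0 !prime_gt0.
  - exact: rM.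
  - by apply/eqP; rewrite natr_Fp_eq0 // (dvdn_trans rd dS).
have cop n : (forall r, prime r -> (r %| d)%N -> ~~ (r %| 2 ^ n - 1)%N) ->
    coprime d (2 ^ n - 1).
  move=> H; rewrite /coprime; apply/negPn/negP => g1.
  have r_pr : prime (pdiv (gcdn d (2 ^ n - 1))).
    by rewrite pdiv_prime // ltn_neqAle eq_sym g1 gcdn_gt0 d_gt0.
  have := pdiv_dvd (gcdn d (2 ^ n - 1)); rewrite dvdn_gcd => /andP[rd rn].
  by move: (H _ r_pr rd); rewrite rn.
split; apply: cop => r r_pr rd; apply/negP => rn;
  have [oddr rM rS rn1] := mod_prime _ _ r_pr rd rn.
- have := gauss_relation rM erefl rS; rewrite rn1 (gaussF1 p_pr p_gt2 gp).
  rewrite mulr0 mul0r !addr0 => /eqP; apply/negP.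
  by apply: gaussF_neqN1 gq _ _ _ _ _ => //; rewrite -exprM.
- have := gauss_relation rM erefl rS; rewrite rn1 (gaussF1 q_pr q_gt2 gq).
  rewrite mulr0 !addr0 => /eqP; apply/negP.
  by apply: gaussF_neqN1 gp _ _ _ _ _ => //; rewrite -exprM mulnC.
Qed.
End Whiteman.

(** * Elimination of the Gauss sums and the size of the gcd *)

Lemma gauss_elimination (R : comNzRingType) (a b eps : R) :
  eps = 1 \/ eps = -1 -> 1 + a + b + eps * a * b = 0 ->
  ((1 + a ^+ 2) * (1 - b ^+ 2)) ^+ 2
  = 4 * a ^+ 2 * (1 - eps * b ^+ 2) ^+ 2.
Proof.
move=> epsP rel; apply/eqP; rewrite -subr_eq0; apply/eqP.
(* The second factor is the relation with b negated; their product is (1 + a^2)(1 - b^2) + 2a(1 -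
   eps b^2). The last factor is this product with a negated, so only even powers survive. *)
transitivity ((1 + a + b + eps * a * b) * ((1 + a - b - eps * a * b) *
  ((1 + a ^+ 2) * (1 - b ^+ 2) - 2 * a * (1 - eps * b ^+ 2)))).
  by case: epsP => ->; ring.
by rewrite rel mul0r.
Qed.

Lemma sqr_succ_le_exp2 n : (6 <= n)%N -> (n.+1 ^ 2 <= 2 ^ n)%N.
Proof.
elim: n => // n IHn; rewrite ltnS leq_eqVlt => /predU1P[<- //|n6].
have := IHn n6; rewrite (expnS 2 n) -!mulnn; move: (2 ^ n)%N => m; nia.
Qed.

(** For p >= 6 the spare factor 2 goes to q, where q = 3 gives 16 <= 16. For p = 5 it goes to p,
    since 36 > 32. The pair (5, 3) needs the subtracted term: 576 - 80 = 496 <= 512. *)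
Lemma whiteman_bound (p q : nat) : (4 < p)%N -> (2 < q)%N -> (q %% 4 = 3)%N ->
  ((p.+1 * q.+1) ^ 2 - 4 * p * q.-1 ^ 2 <= 2 ^ (p + q + 1))%N.
Proof.
move=> p5 q3 q4; have [p6|] := leqP 6 p.
  apply: leq_trans (leq_subr _ _) _.
  rewrite expnMn -addnA expnD leq_mul ?sqr_succ_le_exp2 //.
  have [q6|] := leqP 6 q.
    by apply: leq_trans (sqr_succ_le_exp2 q6) _; rewrite leq_exp2l ?leq_addr.
  by case: q q3 q4 => [|[|[|[|[|[|]]]]]].
rewrite ltnS leq_eqVlt ltnNge p5 orbF => /eqP ->.
have [q6|] := leqP 6 q.
  apply: leq_trans (leq_subr _ _) _.
  rewrite expnMn addnAC expnD leq_mul ?sqr_succ_le_exp2 //.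
by case: q q3 q4 => [|[|[|[|[|[|]]]]]].
Qed.

Lemma natr_Zp_eq0 (d n : nat) : (1 < d)%N -> (n%:R == 0 :> 'Z_d) = (d %| n)%N.
Proof.
move=> d1; have valE : (n%:R : 'Z_d) = (n %% d)%N :> nat := val_Zp_nat d1 n.
apply/eqP/idP => [n0|/eqP dn]; first by rewrite /dvdn -valE n0.
by apply: ord_inj; rewrite valE dn.
Qed.

Lemma whiteman_gcd_le (p q g d : nat) :
  prime p -> prime q -> p != q -> (2 < p)%N -> (2 < q)%N ->
  (p %% 4 = 1)%N -> (q %% 4 = 3)%N -> gcdn p.-1 q.-1 = 2%N ->
  primitive_root_mod p g -> primitive_root_mod q g ->
  (d %| 2 ^ (p * q) - 1)%N -> (d %| S2 p q g)%N ->
  (d <= (p.+1 * q.+1) ^ 2 - 4 * p * q.-1 ^ 2)%N.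
Proof.
move=> p_pr q_pr neq_pq p_gt2 q_gt2 p4 q4 gcd2 gp gq dM dS.
(* Strictness, from 4p < (p + 1)^2, keeps the truncated difference positive, so that a divisor of it
   is bounded by it. *)
have lt_sq (c : nat) : (c <= q.+1)%N -> (4 * p * c ^ 2 < (p.+1 * q.+1) ^ 2)%N.
  move=> cq; apply: (@leq_ltn_trans (4 * p * q.+1 ^ 2)%N).
    by rewrite leq_mul2l leq_sqr cq orbT.
  rewrite expnMn ltn_pmul2r ?expn_gt0 //; move: p_gt2; clear; nia.
have le_of_dvd (c : nat) : (q.-1 <= c <= q.+1)%N ->
    (d %| (p.+1 * q.+1) ^ 2 - 4 * p * c ^ 2)%N ->
    (d <= (p.+1 * q.+1) ^ 2 - 4 * p * q.-1 ^ 2)%N.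
  move=> /andP[qc cq] /dvdn_leq; rewrite subn_gt0 lt_sq // => /(_ isT) d_le.
  by apply: leq_trans d_le _; rewrite leq_sub2l // leq_mul2l leq_sqr qc orbT.
(* ['Z_d] is the ring of integers modulo d only for d > 1. *)
have [d1|d_gt1] := leqP d 1.
  by apply: leq_trans d1 _; rewrite subn_gt0 lt_sq //; move: q_gt2; clear; lia.
have [copq copp] :=
  coprime_gcd_S2 p_pr q_pr neq_pq p_gt2 q_gt2 gp gq p4 q4 gcd2 dM dS.
pose w : 'Z_d := 2.
have wpq : w ^+ (p * q) = 1.
  move: dM; rewrite -natr_Zp_eq0 // natrB ?expn_gt0 // natrX subr_eq0.
  by move/eqP.
have S0 : (S2 p q g)%:R = 0 :> 'Z_d by apply/eqP; rewrite natr_Zp_eq0.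
have rel := gauss_relation p_pr q_pr neq_pq p_gt2 q_gt2 gp gq p4 q4 gcd2
  wpq erefl S0.
have unitw n : coprime d (2 ^ n - 1) -> w ^+ n - 1 \is a GRing.unit.
  by rewrite -unitZpE // natrB ?expn_gt0 // natrX.
have := gaussF_sq p_pr p_gt2 gp _ (unitw _ copq); rewrite -exprM mulnC wpq.
have := gaussF_sq q_pr q_gt2 gq _ (unitw _ copp); rewrite -exprM wpq.
have oddp : odd p.-1./2 = false by move: p4; clear; lia.
have oddq : odd q.-1./2 = true by move: q4; clear; lia.
rewrite -(signr_odd _ p.-1./2) -(signr_odd _ q.-1./2) oddp oddq expr0 expr1.
rewrite mul1r mulN1r => /(_ erefl) Gq /(_ erefl) Gp.
have q1E : (q.-1)%:R = q%:R - 1 :> 'Z_d by rewrite -subn1 natrB // prime_gt0.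
(* The natural number [c] represents 1 + eps q up to sign: q + 1 for eps = 1 and q - 1 for eps = -1.
   Only its square matters. *)
have elim_eps (c : nat) (eps : 'Z_d) : (c <= q.+1)%N -> eps = 1 \/ eps = -1 ->
    (c%:R = 1 + eps * q%:R \/ c%:R = - (1 + eps * q%:R)) ->
    (whiteman_sign p q)%:~R = eps ->
    (d %| (p.+1 * q.+1) ^ 2 - 4 * p * c ^ 2)%N.
  move=> cq epsP cE epsE; rewrite epsE in rel.
  have := gauss_elimination epsP rel; rewrite Gp Gq !opprK mulrN opprK => E.
  rewrite -natr_Zp_eq0 // natrB ?(ltnW (lt_sq _ cq)) // !(natrX, natrM).
  rewrite -(natr1 p) -(natr1 q) subr_eq0 ![_ + 1]addrC E.
  by case: cE => ->; rewrite ?sqrrN.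
have [s1|s1] := whiteman_signP p_pr q_pr neq_pq.
  apply: (le_of_dvd q.+1); first by rewrite leqnn andbT leqW // leq_pred.
  apply: (elim_eps _ 1); rewrite ?leqnn ?s1 //; first by left.
  by left; rewrite mul1r -natr1 addrC.
apply: (le_of_dvd q.-1); first by rewrite leqnn leqW // leq_pred.
apply: (elim_eps _ (-1)); rewrite ?leqW ?leq_pred ?s1 //; first by right.
by right; rewrite q1E mulN1r opprB.
Qed.

Theorem theorem1 (p q g : nat) :
  prime p -> prime q -> p != q -> (2 < p)%N -> (2 < q)%N ->
  (p %% 4 = 1)%N -> (q %% 4 = 3)%N -> gcdn p.-1 q.-1 = 2%N ->
  primitive_root_mod p g -> primitive_root_mod q g ->
  (* |q - p| < sqrt(pq) - 1, i.e. |q - p| + 1 < sqrt(pq) *)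
  (`|(q%:Z - p%:Z)| + 1) ^+ 2 < (p * q)%:Z ->
  (p * q - p - q - 1 <= two_adic_complexity (N p q) (sW p q g))%N.
Proof.
move=> p_pr q_pr neq_pq p_gt2 q_gt2 p4 q4 gcd2 gp gq _.
rewrite /two_adic_complexity -/(S2 p q g) /N.
set d := gcdn _ _; set k := (p * q - p - q - 1)%N.
have d_le : (d <= 2 ^ (p + q + 1))%N.
  apply: (@leq_trans ((p.+1 * q.+1) ^ 2 - 4 * p * q.-1 ^ 2)%N).
    by apply: whiteman_gcd_le gp gq _ _; rewrite // ?dvdn_gcdl ?dvdn_gcdr.
  by apply: whiteman_bound => //; move: p_gt2 p4; clear; lia.
have d_gt0 : (0 < d)%N.
  rewrite gcdn_gt0 subn_gt0 (leq_ltn_trans _ (ltn_expl (p * q) _)) //.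
  by rewrite muln_gt0 !prime_gt0.
(* The truncated subtractions in [k] are exact because p and q are at least 3. *)
have kE : (p * q = k + (p + q + 1))%N.
  by rewrite /k; move: p_gt2 q_gt2; clear; nia.
apply: trunc_log_max => //.
(* It suffices that (2^k - 1) d <= 2^(pq) - 1, which follows from 2^k d <= 2^(pq) and d >= 1. *)
rewrite addnC -leq_subLR leq_divRL // mulnBl mul1n kE expnD.
by rewrite leq_sub // leq_mul2l d_le orbT.
Qed.
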